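(* Let $p$ be a prime and let $a,b\in\mathbb{F}_p^\ast$. Let $n\ge 4$ be a divisor of $p-1$ such that $n^4-2n^3-3n^2-8n\ge 4(p-1)$, and put $k=(p-1)/n$. Then \[ N_n(a,b,p)<n^2\left(3(k/2)^{2/3}-\frac{7}{2}(k/2)^{1/3}+\frac{25}{12}\right). \]
   Context: For a prime $p$, an integer $n>1$ prime to $p$, and $a,b\in\mathbb{F}_p^\ast$, $N_n(a,b,p)$ denotes the number of projective $\mathbb{F}_p$-rational points of the Fermat curve $ax^n+by^n=z^n$ (in homogeneous coordinates $(x:y:z)$) in the projective plane over $\mathbb{F}_p$. *)

(* Defs.v *)
From mathcomp Require Import all_boot all_order all_algebra.
From mathcomp Require Import reals exp.

Set Implicit Arguments.
Unset Strict Implicit.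
Unset Printing Implicit Defensive.

Import Order.TTheory GRing.Theory Num.Theory.
Local Open Scope ring_scope.

Definition same_point (F : finFieldType) (u v : 'rV[F]_3) : bool :=
  [exists c : F, (c != 0) && (v == c *: u)].

(* A point of the projective plane is the class (x : y : z) of its nonzero
   homogeneous coordinate vectors, i.e. a line through 0 with 0 removed. *)
Definition proj_plane (F : finFieldType) : {set {set 'rV[F]_3}} :=
  equivalence_partition (@same_point F) [set v | v != 0].

Definition fermat_eq (F : finFieldType) (n : nat) (a b : F) (v : 'rV[F]_3)
    : bool :=
  let x := v 0 0 in let y := v 0 1 in let z := v 0 2%:R in
  a * x ^+ n + b * y ^+ n == z ^+ n.

(* The equation is homogeneous, so it holds for all homogeneous coordinates
   of a point as soon as it holds for one of them. *)
Definition fermat_points (F : finFieldType) (n : nat) (a b : F)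
    : {set {set 'rV[F]_3}} :=
  [set P in proj_plane F | [forall v in P, fermat_eq n a b v]].

Definition fermat_count (p n : nat) (a b : 'F_p) : nat :=
  #|fermat_points n a b|.

(* Main.v *)
Require Import Defs.
From mathcomp Require Import all_boot all_order all_algebra.
From mathcomp Require Import reals exp.
From mathcomp Require Import all_fingroup all_field zify ring lra.

Set Implicit Arguments.
Unset Strict Implicit.
Unset Printing Implicit Defensive.

Import Order.TTheory GRing.Theory Num.Theory.
Local Open Scope ring_scope.

(** Write [p = n k + 1].  Away from the coordinate lines a point of the curve is
    determined up to [n ^ 2] choices by [u = a x ^ n] (with [z = 1]), which lies in
    [S = {u | u ^ k = a ^ k, (1 - u) ^ k = b ^ k}], so it suffices to bound [#|S|].
    This is done by the Stoehr-Voloch method for curves of degree [m].  With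
    [q = p - k], the polynomials [U = X ^ q] and [V = (1 - X) ^ q] behave under
    differentiation like the [n]-th roots of [X] and [1 - X], while their
    Frobenius twists [CU = X ^ p / a ^ k] and [CV = (1 - X) ^ p / b ^ k] have
    derivative [0] and agree with [U] and [V] on [S].  The determinant whose first
    row is [CU ^ i * CV ^ j], [i + j <= m], and whose other [M] rows are the
    derivatives of order [< M] of [U ^ i * V ^ j], vanishes to order [>= M] at each
    point of [S] by Taylor's formula.  It is nonzero because its leading
    coefficient at [0] is, up to a unit, a Vandermonde determinant of exponents
    that are distinct modulo [p].  Counting its zeros at [0], [1] and infinity as
    well yields, with [d = m + 3] and [e] the number of coordinate lines meeting
    the curve in rational points,
    [4 d #|S| + 8 e + 7 d ^ 2 <= d ^ 3 + 10 d + 16 + 8 k].  The best [d] is the least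
    one with [4 k + 8 <= d (d + 1) (d - 3)], and the hypothesis on [n] says
    precisely that this [d] is at most [n]; the term in [e] then pays for the
    points on the coordinate lines. *)

(** * Determinants with polynomial entries, and Taylor expansion *)

(** The hypothesis is a matrix identity [diag(y ^ r) A = B diag(y ^ e)]. With [y] a local parameter
    it yields the order of vanishing of [\det A], without negative powers of [y]. *)
Lemma det_scale_exp (R : comNzRingType) N (A B : 'M[R]_N) (y : R)
    (r e : 'I_N -> nat) :
  (forall i j, y ^+ r i * A i j = y ^+ e j * B i j) ->
  y ^+ (\sum_i r i) * \det A = y ^+ (\sum_j e j) * \det B.
Proof.
move=> eqAB; rewrite !expr_sum.
have -> : \prod_i y ^+ r i = \det (diag_mx (\row_i y ^+ r i)).
  by rewrite det_diag; apply: eq_bigr => i _; rewrite mxE.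
have -> : \prod_i y ^+ e i = \det (diag_mx (\row_i y ^+ e i)).
  by rewrite det_diag; apply: eq_bigr => i _; rewrite mxE.
rewrite -det_mulmx [RHS]mulrC -det_mulmx; congr (\det _); apply/matrixP=> i j.
by rewrite mul_diag_mx mul_mx_diag !mxE eqAB mulrC.
Qed.

(** Every nonzero term of the Leibniz expansion obeys the bound, since a permutation only reorders
    the column weights [e]. *)
Lemma size_det_weight (F : idomainType) N (A : 'M[{poly F}]_N)
    (r e w : 'I_N -> nat) :
  (forall i j, A i j != 0 -> (size (A i j) + r i <= (e j + w i).+1)%N) ->
  \det A != 0 ->
  (size (\det A) + \sum_i r i <= (\sum_i e i + \sum_i w i).+1)%N.
Proof.
move=> bndA nz_det; set K := _.+1.
suff: (size (\det A) <= K - \sum_i r i)%N.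
  have: (0 < size (\det A))%N by rewrite size_poly_gt0.
  lia.
apply: (leq_trans (size_sum _ _ _)); apply/bigmax_leqP => s _.
rewrite size_Msign.
have [->|nz] := eqVneq (\prod_i A i (s i)) 0; first by rewrite size_poly0.
have nzA i : A i (s i) != 0 by move/prodf_neq0: nz => /(_ i isT).
rewrite size_prod => [|i _]; last exact: nzA.
have: (\sum_i (size (A i (s i)) + r i) <= \sum_i (e (s i) + w i).+1)%N.
  by apply: leq_sum => i _; apply: bndA.
under [X in (_ <= X)%N -> _]eq_bigr do rewrite -addn1.
have eq_e : (\sum_i e (s i) = \sum_i e i)%N by rewrite [RHS](reindex_perm s).
rewrite /K !big_split /= eq_e !sum1_card.
move: (\sum_i size _)%N (\sum_i r _)%N (\sum_i e _)%N (\sum_i w _)%N #|_|.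
by clear => *; lia.
Qed.

(** Cramer's rule: [v *m A *m \adj A] is [\det A] times [v], read at coordinate [i0]. *)
Lemma dvdp_det_row_comb (F : fieldType) N (A : 'M[{poly F}]_N) (v : 'rV_N) y i0 :
  v 0 i0 = 1 -> (forall j, y %| (v *m A) 0 j) -> y %| \det A.
Proof.
move=> v1 dvd_vA.
have -> : \det A = ((v *m A) *m \adj A) 0 i0.
  by rewrite -mulmxA mul_mx_adj mul_mx_scalar mxE v1 mulr1.
rewrite mxE; elim/big_ind: _ => [|f g|j _]; rewrite ?dvdp0 //; first exact: dvdp_add.
by apply: dvdp_mulr.
Qed.

(** The factor of exponent [r] on the left keeps the identity polynomial when [e < r]. The value of
    [H] at [a] carries the falling factorial [e (e - 1) ... (e - r + 1)]. *)
Lemma derivn_XsubC_exp (F : fieldType) (a : F) e h r :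
  exists2 H : {poly F},
    ('X - a%:P) ^+ r * (('X - a%:P) ^+ e * h)^`(r) = ('X - a%:P) ^+ e * H
    & H.[a] = (\prod_(s < r) ('X - s%:R%:P)).[e%:R] * h.[a].
Proof.
elim: r => [|r [H eqH Ha]].
  by exists h; rewrite ?expr0 ?derivn0 ?mul1r // big_ord0 hornerC mul1r.
set g := ('X - a%:P) ^+ e * h in eqH *; set y := 'X - a%:P in g eqH *.
exists (H *+ e - H *+ r + y * H^`()).
  have := congr1 (fun f => y * deriv f) eqH.
  rewrite !derivM !deriv_exp derivXsubC !mul1r -derivnS.
  have E (n : nat) (f : {poly F}) : y * (y ^+ n.-1 *+ n * f) = y ^+ n * f *+ n.
    by case: n => [|n]; rewrite ?mulr0n ?mul0r ?mulr0 // exprS mulrnAl mulrnAr mulrA.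
  rewrite !mulrDr !E => /(canRL (addKr _)).
  rewrite mulrA -exprS => ->; rewrite eqH.
  by rewrite mulrN !mulrnAr; ring.
rewrite big_ord_recr /= hornerM; set c := (\prod_(s < r) _).[_] in Ha *.
by rewrite !hornerE !hornerMn Ha subrr; ring.
Qed.

(** Taylor's formula is centred at the variable ['X] and evaluated at [a]; the terms of order at
    least [M] are multiples of the divisor. *)
Lemma taylor_dvdp (F : fieldType) (f : {poly F}) (a : F) M :
  (forall r, (r < M)%N -> r`!%:R != 0 :> F) ->
  ('X - a%:P) ^+ M %|
    f.[a]%:P - \sum_(r < M) ((r`!%:R)^-1%:P * (a%:P - 'X) ^+ r) * f^`(r).
Proof.
move=> nzfact.
have -> : f.[a]%:P = \sum_(i < M + size f) f^`N(i) * (a%:P - 'X) ^+ i.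
  have <- : (map_poly polyC f).['X + (a%:P - 'X)] = f.[a]%:P.
    by rewrite addrC subrK horner_map.
  rewrite (@nderiv_taylor_wide _ (M + size f)); first last.
  - by rewrite (leq_trans (size_poly _ _)) // leq_addl.
  - exact: mulrC.
  by apply: eq_bigr => i _; rewrite nderivn_map -/(comp_poly _ _) comp_polyXr.
rewrite big_split_ord /= addrAC -sumrB big1 ?add0r => [|i _].
  elim/big_ind: _ => [|g h|i _]; rewrite ?dvdp0 //; first exact: dvdp_add.
  rewrite -(opprB 'X) exprD exprNn.
  by apply: dvdp_mull; apply: dvdp_mulr; apply: dvdp_mull.
rewrite nderivn_def -[f^`N(i) *+ _]mulr_natr -polyC_natr [f^`N(i) * _%:P]mulrC mulrACA -polyCM.
by rewrite mulVf ?nzfact // mul1r mulrC subrr.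
Qed.

(** * Exponents of the monomials of degree at most [m] *)

Definition triangle m : {set 'I_m.+1 * 'I_m.+1} := [set x : 'I_m.+1 * 'I_m.+1 | (x.1 + x.2 <= m)%N].

Definition tcol m (c : 'I_#|triangle m|) : nat * nat :=
  let x := enum_val c in (val x.1, val x.2).

Lemma tcol_le m (c : 'I_#|triangle m|) : ((tcol c).1 + (tcol c).2 <= m)%N.
Proof. by have := enum_valP c; rewrite inE. Qed.

Lemma tcol_inj m : injective (@tcol m).
Proof.
move=> c d [] /val_inj e1 /val_inj e2; apply: enum_val_inj.
by case: (enum_val c) (enum_val d) e1 e2 => [? ?] [? ?] /= -> ->.
Qed.

Lemma tcol_surj m i j : (i + j <= m)%N -> exists c : 'I_#|triangle m|, tcol c = (i, j).
Proof.
move=> le_ijm; have lti : (i < m.+1)%N by lia. have ltj : (j < m.+1)%N by lia.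
have xT : (Ordinal lti, Ordinal ltj) \in triangle m by rewrite inE.
by exists (enum_rank_in xT (Ordinal lti, Ordinal ltj)); rewrite /tcol enum_rankK_in.
Qed.

Lemma big_triangle (R : Type) (idx : R) (op : Monoid.com_law idx) m
    (G : nat -> nat -> R) :
  \big[op/idx]_(c < #|triangle m|) G (tcol c).1 (tcol c).2 =
  \big[op/idx]_(i < m.+1) \big[op/idx]_(j < (m - i).+1) G i j.
Proof.
transitivity (\big[op/idx]_(x in triangle m) G (val x.1) (val x.2)).
  by rewrite big_enum_val.
rewrite (eq_bigl (fun x : 'I_m.+1 * 'I_m.+1 => true && (x.1 + x.2 <= m)%N)); last first.
  by move=> x; rewrite !inE.
rewrite -(pair_big_dep xpredT (fun i j : 'I_m.+1 => (i + j <= m)%N)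
  (fun i j => G i j)) /=.
apply: eq_bigr => i _; rewrite [RHS](big_ord_widen_cond m.+1 xpredT (G i)).
  by apply: eq_bigl => j /=; have := ltn_ord i; lia.
lia.
Qed.

Lemma big_triangle_swap (R : Type) (idx : R) (op : Monoid.com_law idx) m
    (G : nat -> nat -> R) :
  \big[op/idx]_(c < #|triangle m|) G (tcol c).1 (tcol c).2 =
  \big[op/idx]_(j < m.+1) \big[op/idx]_(i < (m - j).+1) G i j.
Proof.
rewrite -(big_triangle op m (fun j i => G i j)).
transitivity (\big[op/idx]_(x in triangle m) G (val x.1) (val x.2)).
  by rewrite big_enum_val.
transitivity (\big[op/idx]_(x in triangle m) G (val x.2) (val x.1)); last first.
  by rewrite big_enum_val.
pose sw (x : 'I_m.+1 * 'I_m.+1) := (x.2, x.1).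
rewrite (reindex_inj (h := sw)) /=; last by move=> [? ?] [? ?] [-> ->].
by apply: eq_bigl => x; rewrite !inE addnC.
Qed.

Lemma sum_ord_rev m (G : nat -> nat) :
  (\sum_(i < m.+1) G (m - i) = \sum_(i < m.+1) G i)%N.
Proof.
rewrite [RHS](reindex_inj rev_ord_inj) /=.
by apply: eq_bigr => i _; rewrite subSS.
Qed.

Lemma card_triangle m : (2 * #|triangle m| = m.+1 * m.+2)%N.
Proof.
have := big_triangle addn m (fun _ _ => 1%N).
rewrite sum1_card card_ord => ->.
rewrite (sum_ord_rev m (fun d => \sum_(j < d.+1) 1)%N).
elim: m => [|m IHm]; first by rewrite !big_ord1.
by rewrite big_ord_recr /= sum1_card card_ord mulnDr IHm; lia.
Qed.

Lemma sum_triangle2 m :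
  (6 * \sum_(c < #|triangle m|) (tcol c).2 = m * m.+1 * m.+2)%N.
Proof.
rewrite (big_triangle addn m (fun _ j => j)).
rewrite (sum_ord_rev m (fun d => \sum_(j < d.+1) j)%N).
have sum_id d : (2 * \sum_(j < d.+1) j = d * d.+1)%N.
  by elim: d => [|d IHd]; rewrite ?big_ord1 // big_ord_recr /= mulnDr IHd; lia.
elim: m => [|m IHm]; first by rewrite !big_ord1.
rewrite big_ord_recr /= mulnDr IHm; have := sum_id m.+1.
by move: (\sum_(j < m.+2) j)%N => S; nia.
Qed.

Lemma sum_triangle12 m :
  (\sum_(c < #|triangle m|) (tcol c).1 = \sum_(c < #|triangle m|) (tcol c).2)%N.
Proof.
by rewrite (big_triangle_swap addn m (fun i _ => i)) (big_triangle addn m (fun _ j => j)).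
Qed.

(** * Changes of basis among monomials *)

Section Bases.
Variable F : fieldType.
Implicit Types P Q : {poly F}.

(* [mono0], [mono1] and [mono_inf] span the same space as [mono]; they are adapted to
   [0], [1] and infinity, where [1 - V], [1 - U] and [V - (-1) ^ q * U] have
   exceptional order. *)
Definition mono (c : nat * nat) P Q := P ^+ c.1 * Q ^+ c.2.
Definition mono0 (c : nat * nat) P Q := P ^+ c.1 * (1 - Q) ^+ c.2.
Definition mono1 (c : nat * nat) P Q := (1 - P) ^+ c.1 * Q ^+ c.2.
Definition mono_inf (a : F) (c : nat * nat) P Q := P ^+ c.1 * (Q - a%:P * P) ^+ c.2.

(** The matrix [Z] is constant and independent of [P] and [Q], so the same [Z] serves the Frobenius
    row and all rows of derivatives. *)
Definition spanned m (phi psi : nat * nat -> {poly F} -> {poly F} -> {poly F}) :=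
  exists Z : 'M[F]_#|triangle m|, forall c P Q,
    phi (tcol c) P Q = \sum_c' psi (tcol c') P Q * (Z c' c)%:P.

Lemma spanned_sum m phi psi (n : nat * nat -> nat)
    (h : nat * nat -> nat -> nat * nat) (g : nat * nat -> nat -> F) :
  (forall c j, (c.1 + c.2 <= m -> j < n c -> (h c j).1 + (h c j).2 <= m)%N) ->
  (forall c P Q, phi c P Q = \sum_(j < n c) (g c j)%:P * psi (h c j) P Q) ->
  spanned m phi psi.
Proof.
move=> le_h phiE.
exists (\matrix_(c', c) \sum_(j < n (tcol c) | h (tcol c) j == tcol c')
          g (tcol c) j) => c P Q.
rewrite phiE; symmetry.
under eq_bigr => c' _ do rewrite mxE rmorph_sum mulr_sumr big_mkcond /=.
rewrite exchange_big /=; apply: eq_bigr => j _.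
have le_c := tcol_le c.
have /tcol_surj [d def_d] := le_h _ j le_c (ltn_ord j).
rewrite -surjective_pairing in def_d.
rewrite (bigD1 d) //= def_d eqxx big1 ?addr0 1?mulrC // => c' nec'.
by rewrite -def_d (inj_eq (@tcol_inj m)) eq_sym (negPf nec').
Qed.

Lemma spanned_mono0 m : spanned m mono0 mono.
Proof.
apply: (spanned_sum (n := fun c => c.2.+1) (h := fun c j => (c.1, j))
  (g := fun c j => (-1) ^+ j * 'C(c.2, j)%:R)) => [[i l] j /=|[i l] P Q]; first lia.
rewrite /mono0 /mono /= exprBn mulr_sumr; apply: eq_bigr => j _.
rewrite expr1n polyCM polyC_exp polyCN polyC1 polyC_natr -mulr_natr; ring.
Qed.

Lemma spanned_mono m : spanned m mono mono1.
Proof.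
apply: (spanned_sum (n := fun c => c.1.+1) (h := fun c j => (j, c.2))
  (g := fun c j => (-1) ^+ j * 'C(c.1, j)%:R)) => [[i l] j /=|[i l] P Q]; first lia.
rewrite /mono1 /mono /= -{1}(subKr 1 P) exprBn mulr_suml; apply: eq_bigr => j _.
rewrite expr1n polyCM polyC_exp polyCN polyC1 polyC_natr -mulr_natr; ring.
Qed.

Lemma spanned_mono_inf a m : spanned m mono (mono_inf a).
Proof.
apply: (spanned_sum (n := fun c => c.2.+1) (h := fun c j => (c.1 + c.2 - j, j)%N)
  (g := fun c j => a ^+ (c.2 - j) * 'C(c.2, j)%:R)) => [[i l] j /=|[i l] P Q]; first lia.
rewrite /mono_inf /mono /= -{1}(subrKC (a%:P * P) Q) exprDn mulr_sumr.
apply: eq_bigr => j _; rewrite -addnBA -1?ltnS // exprD exprMn.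
rewrite polyCM polyC_exp polyC_natr -mulr_natr; ring.
Qed.
End Bases.

(** * A Vandermonde determinant in falling factorials *)

Lemma derivn_falling_free (F : fieldType) M (a : 'I_M -> F) :
  \sum_(s < M) a s *: \prod_(t < s) ('X - t%:R%:P) = 0 -> forall s, a s = 0.
Proof.
have size_ff (s : nat) : size (\prod_(t < s) ('X - (t%:R : F)%:P)) = s.+1.
  by rewrite size_prod_XsubC -sum1_size sum1_card card_ord.
elim: M a => [|M IHM] a; first by move=> _ [].
rewrite big_ord_recr /= => eq0.
have aM : a ord_max = 0.
  have /(congr1 (fun f : {poly F} => f`_M)) := eq0.
  rewrite coefD coefZ coef0 coef_sum big1 ?add0r => [|s _].
    have /monicP : \prod_(t < M) ('X - (t%:R : F)%:P) \is monic.
      exact: monic_prod_XsubC.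
    by rewrite lead_coefE size_ff /= => ->; rewrite mulr1.
  by rewrite coefZ nth_default ?mulr0 // size_ff.
move: eq0; rewrite aM scale0r addr0 => /IHM a0 s.
case: (unliftP ord_max s) => [j ->|->//].
by have := a0 j; congr (a _ = 0); apply: val_inj; rewrite /= /bump leqNgt ltn_ord.
Qed.

(** A left kernel vector gives a combination [G] of falling factorials, of degree less than [N - 1].
    Row [0] vanishes off [c0], so [G] has the [N - 1] distinct roots [x c] and is zero; column [c0]
    then kills the remaining coordinate. *)
Lemma det_falling_neq0 (F : fieldType) N (B : 'M[F]_N) (c0 : 'I_N)
    (x lam : 'I_N -> F) :
  injective x -> (forall c, lam c != 0) ->
  (forall r c, if val r is s.+1
     then B r c = (\prod_(t < s) ('X - t%:R%:P)).[x c] * lam c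
     else (B r c != 0) = (c == c0)) ->
  \det B != 0.
Proof.
case: N B c0 x lam => [|M] B c0 x lam; first by case: c0.
move=> injx nz_lam defB; apply/det0P => -[v /negP nzv vB0]; apply: nzv.
have vB c : v 0 0 * B 0 c + \sum_(s < M) v 0 (lift 0 s) * B (lift 0 s) c = 0.
  by move/rowP: vB0 => /(_ c); rewrite !mxE big_ord_recl.
pose G := \sum_(s < M) v 0 (lift 0 s) *: \prod_(t < s) ('X - (t%:R : F)%:P).
have GE c : \sum_(s < M) v 0 (lift 0 s) * B (lift 0 s) c = G.[x c] * lam c.
  rewrite horner_sum mulr_suml; apply: eq_bigr => s _.
  by have /= -> := defB (lift 0 s) c; rewrite hornerZ mulrA.
have G0 : G = 0.
  apply: (roots_geq_poly_eq0 (rs := [seq x c | c <- enum (predC1 c0)])).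
  - apply/allP => _ /mapP [c + ->]; rewrite mem_enum inE => /negPf nec.
    have := vB c; rewrite GE; have /= := defB 0 c.
    rewrite nec => /negbFE/eqP ->; rewrite mulr0 add0r => /eqP.
    by rewrite mulf_eq0 (negPf (nz_lam c)) orbF.
  - by rewrite map_inj_uniq // enum_uniq.
  - rewrite size_map -cardE cardC1 card_ord /=.
    apply: (leq_trans (size_sum _ _ _)); apply/bigmax_leqP => s _.
    apply: (leq_trans (size_scale_leq _ _)).
    by rewrite size_prod_XsubC -sum1_size sum1_card card_ord.
have v0 s : v 0 (lift 0 s) = 0 by apply: derivn_falling_free G0 s.
apply/eqP/rowP => r; rewrite mxE.
case: (unliftP 0 r) => [s ->|->]; first exact: v0.
have := vB c0; rewrite GE G0 horner0 mul0r addr0 => /eqP.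
by rewrite mulf_eq0; have /= := defB 0 c0; rewrite eqxx => /negPf ->; rewrite orbF => /eqP.
Qed.

(** * Degrees, characteristic [p] and multiplicities of roots *)

Lemma size_derivn_leq (F : fieldType) (f : {poly F}) s :
  f^`(s) != 0 -> (size f^`(s) + s <= size f)%N.
Proof.
elim: s => [|s IHs]; first by rewrite addn0.
rewrite derivnS => nz; have nzs : f^`(s) != 0.
  by apply: contraNneq nz => ->; rewrite deriv0.
by have := lt_size_deriv nzs; have := IHs nzs; lia.
Qed.

Lemma fact_neq0_pchar (F : fieldType) p r :
  p \in [pchar F] -> (r < p)%N -> r`!%:R != 0 :> F.
Proof.
move=> pF ltrp; rewrite -(dvdn_pcharf pF).
have pr := pcharf_prime pF; elim: r ltrp => [|r IHr] ltrp.
  by rewrite fact0 dvdn1; case: eqP pr => // ->.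
by rewrite factS Euclid_dvdM // negb_or IHr ?(ltnW ltrp) // gtnNdvd.
Qed.

Lemma natr_inj_pchar (F : fieldType) p a b :
  p \in [pchar F] -> (a < p)%N -> (b < p)%N -> a%:R = b%:R :> F -> a = b.
Proof.
move=> pF; wlog leab : a b / (a <= b)%N.
  by move=> W lap lbp E; case/orP: (leq_total a b) => /W H; [|symmetry]; apply: H.
move=> _ ltbp E; apply/eqP; rewrite eqn_leq leab -subn_eq0 /=.
have : (p %| b - a)%N by rewrite (dvdn_pcharf pF) natrB // E subrr.
by rewrite /dvdn modn_small //; lia.
Qed.

Lemma dvdp_comp_sub (F : fieldType) (h Y : {poly F}) a :
  Y - a%:P %| (h \Po Y) - h.[a]%:P.
Proof.
have /factor_theorem [g hE] : root (h - h.[a]%:P) a.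
  by rewrite /root !hornerE subrr.
have -> : (h \Po Y) - h.[a]%:P = (h - h.[a]%:P) \Po Y by rewrite comp_polyB comp_polyC.
by rewrite hE comp_polyM comp_polyB comp_polyX comp_polyC dvdp_mull.
Qed.

Lemma dvdp_exp_cancel (F : fieldType) (x : F) (D b : {poly F}) u v :
  ('X - x%:P) ^+ u * D = ('X - x%:P) ^+ v * b -> ('X - x%:P) ^+ (v - u) %| D.
Proof.
move=> E; have [leuv|/ltnW] := leqP u v; last by rewrite -subn_eq0 => /eqP ->; rewrite expr0 dvd1p.
have /(mulfI _) -> : ('X - x%:P) ^+ u * D = ('X - x%:P) ^+ u * (('X - x%:P) ^+ (v - u) * b).
  by rewrite mulrA -exprD subnKC.
- exact: dvdp_mulr.
- by rewrite expf_neq0 // polyXsubC_eq0.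
Qed.

Lemma dvdp_prod_XsubC_exp (F : fieldType) (s : seq F) (g : F -> nat) (D : {poly F}) :
  uniq s -> (forall x, x \in s -> ('X - x%:P) ^+ g x %| D) ->
  \prod_(x <- s) ('X - x%:P) ^+ g x %| D.
Proof.
elim: s => [|x s IHs] /=; first by rewrite big_nil dvd1p.
move=> /andP [xs us] dvd_s; rewrite big_cons Gauss_dvdp.
  rewrite dvd_s ?mem_head //= IHs // => y ys; apply: dvd_s; exact: mem_behead.
apply: coprimep_expl; rewrite coprimep_sym coprimep_XsubC /root horner_prod.
rewrite prodf_seq_neq0; apply/allP => y ys /=.
by rewrite horner_exp hornerXsubC expf_neq0 // subr_eq0; apply: contraNneq xs => ->.
Qed.

Lemma size_prod_XsubC_exp (F : fieldType) (s : seq F) (g : F -> nat) :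
  size (\prod_(x <- s) ('X - x%:P) ^+ g x) = (\sum_(x <- s) g x).+1.
Proof.
elim: s => [|x s IHs]; first by rewrite !big_nil size_poly1.
rewrite !big_cons size_monicM ?monic_exp ?monicXsubC //.
  by rewrite IHs size_exp_XsubC addSn addnS.
by rewrite -size_poly_eq0 IHs.
Qed.

(** * The contact determinant, its zeros and its degree *)

Section ContactMatrix.
Variables (F : fieldType) (p n k m : nat) (al be : F).
Hypotheses (pF : p \in [pchar F]) (def_p : p = (n * k).+1) (k_gt0 : (0 < k)%N).
Hypotheses (al0 : al != 0) (be0 : be != 0).
Hypotheses (ltmn : (m < n)%N) (lemk : (m <= k)%N) (leNp : (#|triangle m| <= p)%N).

Let q := (p - k)%N.
Let N := #|triangle m|.
Let U : {poly F} := 'X^q.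
Let V : {poly F} := (1 - 'X) ^+ q.
Let CU : {poly F} := al^-1%:P * 'X^p.
Let CV : {poly F} := be^-1%:P * (1 - 'X) ^+ p.

Definition contact_mx (phi : nat * nat -> {poly F} -> {poly F} -> {poly F}) : 'M_N :=
  \matrix_(r, c) if val r is s.+1 then (phi (tcol c) U V)^`(s) else phi (tcol c) CU CV.

Lemma qE : (q + k = p)%N.
Proof. by rewrite /q; nia. Qed.

Lemma q_gt0 : (0 < q)%N.
Proof. rewrite /q; nia. Qed.

(** [n q = n p - n k = (n - 1) p + 1], so [q] represents [1 / n] modulo [p]. *)
Lemma natr_nq_eq1 : n%:R * q%:R = 1 :> F.
Proof.
have : (n * q + p = n * p + 1)%N by rewrite /q; nia.
move/(congr1 (fun a => a%:R : F)); rewrite !natrD !natrM.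
by rewrite (pcharf0 pF) mulr0 add0r addr0.
Qed.

Lemma frob1X : (1 - 'X) ^+ p = 1 - 'X^p :> {poly F}.
Proof.
have pP : p \in [pchar {poly F}] by rewrite pchar_poly.
by have := pFrobenius_autB_comm pP (mulrC 1 'X); rewrite !pFrobenius_autE expr1n.
Qed.

Lemma det_contact_spanned phi psi :
  spanned m phi psi -> exists z, \det (contact_mx phi) = z *: \det (contact_mx psi).
Proof.
move=> [Z phiE].
have derivnMC (f : {poly F}) a s : (f * a%:P)^`(s) = f^`(s) * a%:P.
  by rewrite mulrC mul_polyC derivnZ -mul_polyC mulrC.
have -> : contact_mx phi = contact_mx psi *m map_mx polyC Z.
  apply/matrixP=> r c; rewrite !mxE phiE.
  case E: (val r) => [|s].
    by apply: eq_bigr => d _; rewrite !mxE E.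
  rewrite phiE linear_sum; apply: eq_bigr => d _; rewrite !mxE E.
  exact: derivnMC.
by exists (\det Z); rewrite det_mulmx det_map_mx mulrC mul_polyC.
Qed.

(** Row [0] minus the Taylor polynomial built from the other rows is highly divisible in each
    column: the Frobenius entry is constant modulo the [p]-th power of ['X - x%:P], and that
    constant is the value of the [U], [V] monomial at [x]. *)
Lemma dvdp_contact_point x : x ^+ k = al -> (1 - x) ^+ k = be ->
  ('X - x%:P) ^+ N.-1 %| \det (contact_mx (@mono0 F)).
Proof.
move=> xk yk.
have N_gt0 : (0 < N)%N by have := card_triangle m; rewrite -/N; lia.
have predN : N = N.-1.+1 by rewrite prednK.
have x0 : x != 0 by apply: contraNneq al0 => x0; rewrite -xk x0 expr0n gtn_eqF.
pose v : 'rV[{poly F}]_N := \row_r if val r is s.+1 then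
   - ((s`!%:R)^-1%:P * (x%:P - 'X) ^+ s) else 1.
apply: (@dvdp_det_row_comb _ _ _ v _ (Ordinal N_gt0)); first by rewrite mxE.
move=> c; rewrite mxE.
pose f := mono0 (tcol c) U V; pose h := mono0 (tcol c) (al^-1%:P * 'X) (be^-1%:P * (1 - 'X)).
have hE : mono0 (tcol c) CU CV = h \Po 'X^p.
  rewrite /h /mono0 comp_polyM !rmorphXn /= !(comp_polyB, comp_polyM, comp_polyC) comp_polyX.
  by rewrite /CU /CV frob1X.
(* Since [q + k = p], at a solution [x ^ q = x ^ p / al] and [(1 - x) ^ q = (1 - x) ^ p / be]. *)
have fE : f.[x] = h.[x ^+ p].
  rewrite /f /h /mono0 /U /V !hornerE.
  have -> : (1 - x) ^+ q = (1 - x ^+ p) * be^-1.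
    have /(congr1 (fun g : {poly F} => g.[x])) := frob1X.
    by rewrite !hornerE -qE exprD yk => <-; rewrite mulfK.
  by rewrite -qE exprD xk !(mulrC _^-1) mulfK.
have -> : \sum_j v 0 j * contact_mx (@mono0 F) j c =
   (h \Po 'X^p - h.[x ^+ p]%:P) + (f.[x]%:P -
    \sum_(r < N.-1) ((r`!%:R)^-1%:P * (x%:P - 'X) ^+ r) * f^`(r)).
  rewrite fE addrA subrK.
  pose g j : {poly F} := (if j is s.+1 then - ((s`!%:R)^-1%:P * (x%:P - 'X) ^+ s) else 1)
    * (if j is s.+1 then f^`(s) else mono0 (tcol c) CU CV).
  transitivity (\sum_(j < N) g j).
    by apply: eq_bigr => j _; rewrite /g !mxE /=; case: (nat_of_ord j).
  rewrite predN big_ord_recl /= /g mul1r hE -sumrN; congr (_ + _).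
  by apply: eq_bigr => s _; rewrite /= mulNr.
apply: dvdp_add; last first.
  by apply: taylor_dvdp => r ltr; apply: fact_neq0_pchar pF _; have := leNp; rewrite -/N; lia.
apply: dvdp_trans (dvdp_comp_sub _ _ _).
have pP : p \in [pchar {poly F}] by rewrite pchar_poly.
have -> : 'X^p - (x ^+ p)%:P = ('X - x%:P) ^+ p :> {poly F}.
  have := pFrobenius_autB_comm pP (mulrC 'X x%:P).
  by rewrite !pFrobenius_autE polyC_exp.
by apply: dvdp_exp2l; have := leNp; rewrite -/N; lia.
Qed.

(** Exponent of the local parameter by which a row is multiplied: [s] derivatives lose at most [s]
    orders, and [w] makes up the order missing in row [0]. *)
Definition row_weight w (r : 'I_N) : nat := if val r is s.+1 then s else w.

Lemma sum_row_weight w :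
  (2 * \sum_r row_weight w r = 2 * w + N.-1 * N.-2)%N.
Proof.
have N_gt0 : (0 < N)%N by have := card_triangle m; rewrite -/N; lia.
pose g j : nat := if j is s.+1 then s else w.
transitivity (2 * \sum_(j < N) g j)%N.
  by congr (2 * _)%N; apply: eq_bigr => j _; rewrite /g /row_weight /=.
rewrite -(prednK N_gt0) big_ord_recl /= mulnDr; congr (_ + _)%N.
elim: N.-1 => [|M IHM]; first by rewrite big_ord0.
by rewrite big_ord_recr /= mulnDr IHM; case: M {IHM} => //=; lia.
Qed.

Lemma contact_exp_factor phi (a : F) w (e : 'I_N -> nat) :
  (forall c, exists b, ('X - a%:P) ^+ w * phi (tcol c) CU CV = ('X - a%:P) ^+ e c * b) ->
  (forall c, exists h, phi (tcol c) U V = ('X - a%:P) ^+ e c * h) ->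
  exists b, ('X - a%:P) ^+ (\sum_r row_weight w r) * \det (contact_mx phi) =
            ('X - a%:P) ^+ (\sum_c e c) * b.
Proof.
move=> row0 rowS.
have entry rc : exists b, ('X - a%:P) ^+ row_weight w rc.1 * contact_mx phi rc.1 rc.2
    = ('X - a%:P) ^+ e rc.2 * b.
  case: rc => r c; rewrite mxE /row_weight /=; case: (nat_of_ord r) => [|s] //.
  have [h ->] := rowS c; have [H -> _] := derivn_XsubC_exp a (e c) h s.
  by exists H.
have [B defB] := fin_all_exists entry.
exists (\det (\matrix_(r, c) B (r, c))).
by apply: det_scale_exp => r c; rewrite (defB (r, c)) mxE.
Qed.

Lemma subr1X_exp j : exists h : {poly F}, 1 - 'X ^+ j = ('X - 1%:P) * h.
Proof.
exists (- \sum_(i < j) 'X ^+ i).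
by rewrite mulrN -subrX1 opprB.
Qed.

(** At [1], [1 - U] vanishes to order at least [1] and [V] to order [q]. In row [0], [CV] has order
    [p], and so has [1 - CU] if [al = 1]; otherwise [1 - CU] is a unit there and the weight [m]
    covers the missing order [i <= m]. *)
Lemma contact_at1 : exists b,
  ('X - 1%:P) ^+ (\sum_r row_weight (if al == 1%R then 0 else m)%N r) *
    \det (contact_mx (@mono1 F)) =
  ('X - 1%:P) ^+ (\sum_(c < N) ((tcol c).1 + q * (tcol c).2)) * b.
Proof.
set y := 'X - 1%:P.
have sgn j : (1 - 'X) ^+ j = y ^+ j * (-1) ^+ j.
  by rewrite -exprMn /y polyC1; congr (_ ^+ _); ring.
have CVE : CV = be^-1%:P * (-1) ^+ p * y ^+ p.
  by rewrite /CV sgn mulrA mulrAC.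
have split_exp u v : (u <= v)%N -> y ^+ v = y ^+ u * y ^+ (v - u).
  by move=> leuv; rewrite -exprD subnKC.
apply: contact_exp_factor => c; have := tcol_le c; rewrite /mono1;
    case: (tcol c) => i l /= le_il.
  case: eqP => [al1|_].
    have CUE : 1 - CU = y ^+ p * (-1) ^+ p.
      by rewrite /CU al1 invr1 polyC1 mul1r -frob1X sgn.
    exists (y ^+ (p * i + p * l - (i + q * l)) *
      ((-1) ^+ p) ^+ i * (be^-1%:P * (-1) ^+ p) ^+ l).
    transitivity (y ^+ (p * i + p * l) * (((-1) ^+ p) ^+ i * (be^-1%:P * (-1) ^+ p) ^+ l)).
      by rewrite expr0 mul1r CUE CVE 2!exprMn -!exprM exprD; ring.
    by rewrite (split_exp (i + q * l)%N); [ring | have := qE; nia].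
  exists (y ^+ (m + p * l - (i + q * l)) * (1 - CU) ^+ i
      * (be^-1%:P * (-1) ^+ p) ^+ l).
  transitivity (y ^+ (m + p * l) * ((1 - CU) ^+ i * (be^-1%:P * (-1) ^+ p) ^+ l)).
    by rewrite CVE exprMn -!exprM exprD; ring.
  by rewrite (split_exp (i + q * l)%N); [ring | have := qE; nia].
have [h hE] := subr1X_exp q.
exists (h ^+ i * (-1) ^+ (q * l)).
by rewrite /U /V hE -exprM sgn exprMn exprD; ring.
Qed.

Let a := (-1) ^+ q : F.

(** [a] is the leading coefficient of [V], so the terms of degree [q] cancel. *)
Lemma size_VU : (size (V - a%:P * U)%R <= q)%N.
Proof.
have -> : V - a%:P * U = (-1) ^+ q * (('X - 1) ^+ q - 'X ^+ q).
  rewrite mulrBr -exprMn /V /U /a polyC_exp polyCN polyC1; congr (_ ^+ _ - _); ring.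
rewrite size_Msign subrXX; have -> : 'X - 1 - 'X = - (1 : {poly F}) by ring.
rewrite mulN1r size_polyN; apply: (leq_trans (size_sum _ _ _)).
apply/bigmax_leqP => i _.
apply: (leq_trans (size_polyMleq _ _)); rewrite size_polyXn -polyC1 size_exp_XsubC.
by have := ltn_ord i; lia.
Qed.

Lemma size_mono_inf (i l u v : nat) (P Q : {poly F}) :
  (size P <= u.+1)%N -> (size (Q - a%:P * P)%R <= v.+1)%N ->
  (size (mono_inf a (i, l) P Q) <= (u * i + v * l).+1)%N.
Proof.
move=> sP sQ; apply: (leq_trans (size_polyMleq _ _)) => /=.
have sPi : (size (P ^+ i) <= (u * i).+1)%N.
  by apply: leq_trans (size_poly_exp_leq P i) _; rewrite ltnS leq_mul2r; lia.
have sQl : (size ((Q - a%:P * P) ^+ l)%R <= (v * l).+1)%N.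
  by apply: leq_trans (size_poly_exp_leq _ l) _; rewrite ltnS leq_mul2r; lia.
by rewrite -subn1 leq_subLR (leq_trans (leq_add sPi sQl)) //; lia.
Qed.

(** Row [0] exceeds the column degrees [q i + (q - 1) l]: degree [p = q + k] in place of [q] costs
    at most [k m]. A further [m] is due to [CV - a CU] having degree [p] as well, unless its leading
    coefficient vanishes and it is constant. *)
Lemma size_contact : \det (contact_mx (mono_inf a)) != 0 ->
  (size (\det (contact_mx (mono_inf a))) + \sum_r row_weight 0 r <=
   (\sum_(c < N) (q * (tcol c).1 + (q.-1) * (tcol c).2) +
     (k * m + if (be^-1 + a * al^-1)%R == 0%R then 0 else m)).+1)%N.
Proof.
set w := (k * m + _)%N.
have N_gt0 : (0 < N)%N by have := card_triangle m; rewrite -/N; lia.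
have -> : w = (\sum_(r < N) if val r is s.+1 then 0 else w)%N.
  by rewrite -(prednK N_gt0) big_ord_recl /= big1 ?addn0.
apply: size_det_weight => r c; have := tcol_le c; rewrite mxE /row_weight.
have := qE; have := q_gt0 => q0 qk.
case: (tcol c) => i l /= le_il; case: (nat_of_ord r) => [_|s /size_derivn_leq].
  rewrite addn0.
  have sU : (size CU <= p.+1)%N.
    by rewrite /CU mul_polyC; apply: leq_trans (size_scale_leq _ _) _; rewrite size_polyXn.
  have CE : CV - a%:P * CU = be^-1%:P - (be^-1 + a * al^-1)%:P * 'X^p.
    by rewrite /CV /CU frob1X !(polyCD, polyCM); ring.
  rewrite /w; case: eqP CE => [->|_] CE.
    have := @size_mono_inf i l p 0 CU CV sU; rewrite CE polyC0 mul0r subr0 size_polyC_leq1.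
    by move/(_ isT) => /leq_trans; apply; rewrite -qE mulnDl; nia.
  have sV : (size (CV - a%:P * CU)%R <= p.+1)%N.
    rewrite CE; apply: leq_trans (size_polyD _ _) _; rewrite geq_max size_polyN.
    rewrite (leq_trans (size_polyC_leq1 _)) // mul_polyC.
    by apply: leq_trans (size_scale_leq _ _) _; rewrite size_polyXn.
  have /leq_trans := size_mono_inf i l sU sV; apply.
  by rewrite -qE !mulnDl; have := q_gt0; nia.
have sU : (size U <= q.+1)%N by rewrite size_polyXn.
have sV : (size (V - a%:P * U)%R <= q.-1.+1)%N by rewrite prednK // size_VU.
by move=> /= le_f; apply: leq_trans le_f _; rewrite addn0; exact: size_mono_inf.
Qed.

(** Once the column order is removed, the power of ['X] left is [k i + (p - 1) l] if [be = 1] and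
    [k i + (m - l)] otherwise. It is zero only in column [(0, 0)], respectively [(0, m)]. *)
Lemma contact_row0_at0 : exists c0 : 'I_N, forall c, exists b,
  ('X - 0%:P) ^+ (if be == 1%R then 0 else m)%N * mono0 (tcol c) CU CV =
    ('X - 0%:P) ^+ (q * (tcol c).1 + (tcol c).2) * b
  /\ (b.[0] != 0) = (c == c0).
Proof.
rewrite subr0; have k1 := k_gt0; have qk := qE; have q0 := q_gt0.
have [c0 def_c0] : exists c0, @tcol m c0 = (0, if be == 1%R then 0 else m)%N.
  by apply: tcol_surj; case: ifP => _; lia.
exists c0 => c; have c_c0 : (c == c0) = (tcol c == tcol c0) by rewrite (inj_eq (@tcol_inj m)).
rewrite {}c_c0 {}def_c0; have := tcol_le c; rewrite /mono0; case: (tcol c) => i l /= le_il.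
have split_exp u v : (u <= v)%N -> 'X^v = 'X^u * 'X^(v - u) :> {poly F}.
  by move=> leuv; rewrite -exprD subnKC.
have natb (b : bool) : (b%:R != 0 :> F) = b by case: b; rewrite ?oner_eq0 ?eqxx.
have al_i : al^-1 ^+ i != 0 by rewrite expf_neq0 ?invr_eq0.
rewrite xpair_eqE; case: (eqVneq be 1) => [be1|be1].
  have CVE : 1 - CV = 'X^p by rewrite /CV be1 invr1 polyC1 mul1r frob1X subKr.
  exists ('X^(p * i + p * l - (q * i + l)) * (al^-1 ^+ i)%:P); split.
    rewrite CVE expr0 mul1r /CU exprMn -!exprM mulrA -split_exp; last nia.
    by rewrite exprD polyC_exp; ring.
  rewrite !hornerE mulf_eq0 (negPf al_i) orbF expr0n natb.
  have -> : (p * i + p * l - (q * i + l) = k * i + p.-1 * l)%N by rewrite -qk; nia.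
  by rewrite addn_eq0 !muln_eq0 [k == 0%N]gtn_eqF // [p.-1 == 0%N]gtn_eqF //; lia.
have CVE : 1 - CV = 1 - be^-1%:P + be^-1%:P * 'X^p.
  by rewrite /CV frob1X; ring.
exists ('X^(m + p * i - (q * i + l)) * ((al^-1 ^+ i)%:P * (1 - CV) ^+ l)); split.
  rewrite /CU exprMn -exprM [RHS]mulrA -split_exp; last nia.
  by rewrite exprD polyC_exp; ring.
have nz : ((al^-1 ^+ i)%:P * (1 - CV) ^+ l).[0] != 0.
  rewrite CVE !hornerE mulf_neq0 // expf_neq0 // expr0n gtn_eqF; last by lia.
  by rewrite mulr0 addr0 subr_eq0 eq_sym invr_eq1.
rewrite hornerM mulf_eq0 (negPf nz) orbF hornerXn expr0n natb.
have -> : (m + p * i - (q * i + l) = k * i + (m - l))%N by rewrite -qk; nia.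
by rewrite addn_eq0 muln_eq0 [k == 0%N]gtn_eqF //=; lia.
Qed.

(** Here the order is exact, which shows that the determinant is nonzero. The leading coefficients
    in the rows of derivatives are falling factorials at [q i + l], times [q ^ l] because [1 - V]
    starts with [q X]. *)
Lemma contact_at0 : exists b,
  ('X - 0%:P) ^+ (\sum_r row_weight (if be == 1%R then 0 else m)%N r) *
    \det (contact_mx (@mono0 F)) =
  ('X - 0%:P) ^+ (\sum_(c < N) (q * (tcol c).1 + (tcol c).2)) * b
  /\ b.[0] != 0.
Proof.
have [c0 row0] := contact_row0_at0.
set w := (X in row_weight X).
pose e (c : 'I_N) := (q * (tcol c).1 + (tcol c).2)%N.
have n_gt0 : (0 < n)%N by have := ltmn; lia.
have entry rc : exists b, ('X - 0%:P) ^+ row_weight w rc.1 * contact_mx (@mono0 F) rc.1 rc.2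
    = ('X - 0%:P) ^+ e rc.2 * b /\
    (if val rc.1 is s.+1
     then b.[0] = (\prod_(t < s) ('X - t%:R%:P)).[(e rc.2)%:R] * q%:R ^+ (tcol rc.2).2
     else (b.[0] != 0) = (rc.2 == c0)).
  case: rc => r c; rewrite mxE /row_weight /=; case: (nat_of_ord r) => [|s].
    exact: row0.
  pose h : {poly F} := (\sum_(i < q) (1 - 'X) ^+ i) ^+ (tcol c).2.
  have [H EH vH] := derivn_XsubC_exp 0 (e c) h s.
  exists H; split.
    suff -> : mono0 (tcol c) U V = ('X - 0%:P) ^+ e c * h by [].
    rewrite /mono0 /U /V subr0 /e /h.
    have -> : 1 - (1 - 'X) ^+ q = 'X * \sum_(i < q) (1 - 'X) ^+ i :> {poly F}.
      by rewrite -opprB subrX1; ring.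
    by rewrite exprMn -exprM mulrA exprD.
  suff hq : q%:R ^+ (tcol c).2 = h.[0] by rewrite vH hq.
  rewrite /h horner_exp horner_sum (eq_bigr (fun=> 1)) => [|j _].
    by rewrite sumr_const card_ord.
  by rewrite !hornerE subr0 expr1n.
have [B defB] := fin_all_exists entry.
pose B' : 'M_N := \matrix_(r, c) B (r, c).
exists (\det B'); split.
  by apply: det_scale_exp => r c; rewrite [B' r c]mxE; case: (defB (r, c)).
have -> : (\det B').[0] = \det (map_mx (horner_eval 0) B') by rewrite det_map_mx.
have nzq : q%:R != 0 :> F.
  by apply/eqP=> q0; have /eqP := natr_nq_eq1; rewrite q0 mulr0 eq_sym oner_eq0.
apply: (@det_falling_neq0 _ _ _ c0 (fun c => (e c)%:R) (fun c => q%:R ^+ (tcol c).2)).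
(* Multiplication by [n] turns [q i + l] into [i + n l] modulo [p]. As [i <= m < n] and
   [i + n l <= n m <= n k < p], base [n] digits recover [(i, l)]. *)
- move=> c d ecd; apply: tcol_inj.
  have modn (c' : 'I_N) : n%:R * (e c')%:R = (n * (tcol c').2 + (tcol c').1)%:R :> F.
    by rewrite /e !natrD !natrM mulrDr mulrA natr_nq_eq1 mul1r addrC.
  have ltp (c' : 'I_N) : (n * (tcol c').2 + (tcol c').1 < p)%N.
    have := leq_mul (leqnn n) (leq_trans (@tcol_le m c') lemk).
    have := leq_pmull (tcol c').1 n_gt0; rewrite def_p mulnDr; lia.
  have /(congr1 (fun z => n%:R * z)) := ecd; rewrite !modn => /(natr_inj_pchar pF) H.
  have {}H := H (ltp c) (ltp d).
  have := tcol_le c; have := tcol_le d; have := ltmn; move: H.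
  case: (tcol c) (tcol d) => [i l] [i' l'] /=; move=> H *.
  have el : l = l' by nia.
  by subst l'; congr (_, _); lia.
- by move=> c; rewrite expf_neq0.
- move=> r c; rewrite !mxE /horner_eval; have [_] := defB (r, c).
  by case: (val r).
Qed.

(** Let [T] be the sum of the second exponents. Up to row weights, the zeros at [0] and [1] number
    [2 (q + 1) T] and the degree is [(2 q - 1) T]; the surplus [3 T] joins the [N.-1] zeros at each
    point of [s]. *)
Lemma stepanov_bound (s : seq F) :
  uniq s -> (forall x, x \in s -> x ^+ k = al /\ (1 - x) ^+ k = be) ->
  (2 * (N.-1 * size s) + 6 * \sum_(c < N) (tcol c).2 <=
   N.-1 * N.-2 + 2 * ((if be == 1%R then 0 else m) + (if al == 1%R then 0 else m)
    + (k * m + if (be^-1 + a * al^-1)%R == 0%R then 0 else m)))%N.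
Proof.
move=> uniq_s s_sol; set D := \det (contact_mx (@mono0 F)).
set w0 := (if be == _ then _ else _); set w1 := (if al == _ then _ else _).
have [b0 [D0 b00]] := contact_at0; rewrite -/w0 -/D in D0.
have [b1 D1] := contact_at1; rewrite -/w1 in D1.
have nzD : D != 0.
  apply: contraNneq b00 => D_0; move/eqP: D0; rewrite D_0 mulr0 eq_sym mulf_eq0.
  by rewrite expf_eq0 polyXsubC_eq0 andbF /= => /eqP->; rewrite horner0.
have [z Dz] := det_contact_spanned (spanned_mono0 F m).
have [z1 Dz1] := det_contact_spanned (spanned_mono F m).
have [zoo Dzoo] := det_contact_spanned (spanned_mono_inf a m).
have D1' : ('X - 1%:P) ^+ (\sum_r row_weight w1 r) * D =
    ('X - 1%:P) ^+ (\sum_(c < N) ((tcol c).1 + q * (tcol c).2)) * ((z * z1) *: b1).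
  by rewrite /D Dz Dz1 scalerA -!scalerAr D1.
have DDoo : D = (z * zoo) *: \det (contact_mx (mono_inf a)).
  by rewrite /D Dz Dzoo scalerA.
have nzDoo : \det (contact_mx (mono_inf a)) != 0.
  by apply: contraNneq nzD => E; rewrite DDoo E scaler0.
have sizeD : (size D <= size (\det (contact_mx (mono_inf a))))%N.
  by rewrite DDoo size_scale_leq.
have := size_contact nzDoo; set woo := (k * m + _)%N => size_oo.
(* Lower bounds for multiplicities; a negative difference truncates to [0], still a valid bound. *)
pose g (x : F) := if x == 0 then (\sum_(c < N) (q * (tcol c).1 + (tcol c).2) -
   \sum_r row_weight w0 r)%N else if x == 1 then
   (\sum_(c < N) ((tcol c).1 + q * (tcol c).2) - \sum_r row_weight w1 r)%N else N.-1.
have s0 x : x \in s -> (x != 0) && (x != 1).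
  move=> /s_sol [xk yk]; apply/andP; split.
    by apply: contraNneq al0 => x0; rewrite -xk x0 expr0n gtn_eqF.
  by apply: contraNneq be0 => x1; rewrite -yk x1 subrr expr0n gtn_eqF.
have dvdD : \prod_(x <- [:: 0, 1 & s]) ('X - x%:P) ^+ g x %| D.
  apply: dvdp_prod_XsubC_exp.
    rewrite /= uniq_s !inE negb_or eq_sym oner_eq0 andbT /=.
    by apply/andP; split; apply/negP => /s0; rewrite eqxx ?andbF.
  move=> x; rewrite /g !inE; case: eqP => [-> _|_] /=; first exact: dvdp_exp_cancel D0.
  case: eqP => [-> _|_] /=; first exact: dvdp_exp_cancel D1'.
  by move=> /s_sol [xk yk]; exact: dvdp_contact_point.
have sum_g : (\sum_(x <- s) g x = N.-1 * size s)%N.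
  rewrite -iter_addn_0 -(count_predT s) -big_const_seq; apply: eq_big_seq => x /s0.
  by rewrite /g => /andP [/negPf -> /negPf ->].
have := dvdp_leq nzD dvdD; rewrite size_prod_XsubC_exp !big_cons sum_g.
rewrite /g eqxx oner_eq0 eqxx.
have := sum_row_weight w0; have := sum_row_weight w1; have := sum_row_weight 0.
have e0 : (\sum_(c < N) (q * (tcol c).1 + (tcol c).2) = q.+1 * \sum_(c < N) (tcol c).2)%N.
  by rewrite big_split -big_distrr /= sum_triangle12 mulSn addnC.
have e1 : (\sum_(c < N) ((tcol c).1 + q * (tcol c).2) = q.+1 * \sum_(c < N) (tcol c).2)%N.
  by rewrite big_split -big_distrr /= sum_triangle12 mulSn.
have eoo : (\sum_(c < N) (q * (tcol c).1 + q.-1 * (tcol c).2) + \sum_(c < N) (tcol c).2 =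
   2 * q * \sum_(c < N) (tcol c).2)%N.
  rewrite big_split -!big_distrr /= sum_triangle12; have := q_gt0.
  by move: (\sum_(c < N) _)%N q => T [|q'] //= _; nia.
move: size_oo sizeD eoo; rewrite e0 e1 {e0 e1}.
move: (\sum_r row_weight 0 r)%N (\sum_r row_weight w0 r)%N (\sum_r row_weight w1 r)%N.
move: (\sum_(c < N) (q * (tcol c).1 + q.-1 * (tcol c).2))%N (\sum_(c < N) (tcol c).2)%N.
move: (size D) (size _); clear.
nia.
Qed.
End ContactMatrix.

(** * From points of the curve to points of a line *)

Lemma leq_card_bigcup (I T : finType) (P : pred I) (A : I -> {set T}) :
  (#|\bigcup_(i | P i) A i| <= \sum_(i | P i) #|A i|)%N.
Proof.
elim/big_ind2: _ => [|u B v C lB lC|//]; first by rewrite cards0.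
  by apply: leq_trans (leq_of_leqif (leq_card_setU B C)) _; rewrite leq_add.
Qed.

Lemma card_nth_roots (F : finFieldType) n (w : F) :
  (0 < n)%N -> (#|[set x : F | (x ^+ n == w)%R]| <= n)%N.
Proof.
move=> n_gt0; have sz := size_XnsubC w n_gt0.
have nz : 'X^n - w%:P != 0 :> {poly F} by rewrite -size_poly_gt0 sz.
have := max_poly_roots nz (rs := enum [set x : F | x ^+ n == w]).
rewrite enum_uniq -cardE sz ltnS; apply => //.
by apply/allP => x; rewrite mem_enum inE /root !hornerE subr_eq0.
Qed.

Section CountPoints.
Variables (F : finFieldType) (n k : nat) (a b : F).
Hypotheses (n_gt0 : (0 < n)%N) (cardF : #|F| = (n * k).+1).
Hypotheses (a0 : a != 0) (b0 : b != 0).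

Definition line_points := [set x : F | (x ^+ k == a ^+ k) && ((1 - x) ^+ k == b ^+ k)].

Let row3 (x y z : F) : 'rV[F]_3 := \row_(i < 3) nth 0 [:: x; y; z] i.
Let point (v : 'rV[F]_3) : {set 'rV[F]_3} := [set w in [set w | w != 0] | same_point v w].

Lemma exp_pow_nk (x : F) : x != 0 -> (x ^+ n) ^+ k = 1.
Proof.
move=> x0; apply: (mulfI x0).
by rewrite mulr1 -exprM -exprS -cardF expf_card.
Qed.

Lemma row3E (v : 'rV[F]_3) : v = row3 (v 0 0) (v 0 1) (v 0 2%:R).
Proof.
apply/rowP => -[[|[|[|//]]] lti]; rewrite !mxE /=; congr (v _ _); exact: val_inj.
Qed.

Lemma point_scale c v : c != 0 -> point (c *: v) = point v.
Proof.
move=> c0; apply/setP => w; rewrite !inE; congr (_ && _).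
apply/existsP/existsP => -[d /andP [d0 /eqP ->]].
  by exists (d * c); rewrite mulf_neq0 //= scalerA.
by exists (d / c); rewrite mulf_neq0 ?invr_eq0 //= scalerA divfK.
Qed.

(** Points with [z != 0] are scaled to [z = 1]. If [z = 0] then [y != 0], for otherwise
    [a x ^ n = 0] makes all coordinates vanish; these are scaled to [y = 1]. *)
Lemma fermat_points_sub : fermat_points n a b \subset
  [set point (row3 xy.1 xy.2 1) | xy in [set xy : F * F | a * xy.1 ^+ n + b * xy.2 ^+ n == 1]]
  :|: [set point (row3 x 1 0) | x in [set x : F | a * x ^+ n + b == 0]].
Proof.
apply/subsetP => P; rewrite inE => /andP [/imsetP [v]]; rewrite inE => v0 defP.
have {}defP : P = point v by [].
have normalize c : c != 0 -> P = point (c *: v) /\ c *: v \in P.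
  move=> c0; rewrite point_scale //; split=> //.
  rewrite defP !inE scaler_eq0 negb_or c0 v0 /=.
  by apply/existsP; exists c; rewrite c0 eqxx.
move=> /forallP eqP_; have {eqP_}eqP_ w : w \in P -> fermat_eq n a b w.
  by move=> wP; have := eqP_ w; rewrite wP.
rewrite inE; have [z0|z0] := eqVneq (v 0 2%:R) 0; last first.
  have /normalize [PE vP] : (v 0 2%:R)^-1 != 0 by rewrite invr_eq0.
  apply/orP; left; apply/imsetP.
  exists ((v 0 2%:R)^-1 * v 0 0, (v 0 2%:R)^-1 * v 0 1).
    by have := eqP_ _ vP; rewrite inE /fermat_eq !mxE mulVf // expr1n.
  by rewrite PE [in LHS](row3E (_ *: _)) !mxE mulVf.
have y0 : v 0 1 != 0.
  apply/eqP => y0; have := eqP_ _ (normalize 1 (oner_neq0 _)).2.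
  rewrite scale1r /fermat_eq y0 z0 expr0n gtn_eqF //= mulr0 addr0 mulf_eq0 (negPf a0) /=.
  rewrite expf_eq0 n_gt0 /= => /eqP x0; case/eqP: v0.
  by rewrite (row3E v) x0 y0 z0; apply/rowP => -[[|[|[|//]]] lti]; rewrite !mxE.
have /normalize [PE vP] : (v 0 1)^-1 != 0 by rewrite invr_eq0.
apply/orP; right; apply/imsetP; exists ((v 0 1)^-1 * v 0 0).
  have := eqP_ _ vP; rewrite inE /fermat_eq !mxE mulVf // z0 mulr0 expr1n mulr1.
  by rewrite expr0n gtn_eqF.
by rewrite PE [in LHS](row3E (_ *: _)) !mxE mulVf // z0 mulr0.
Qed.

(** [e] is a necessary condition for solvability: when it fails the set is empty. *)
Lemma card_scaled_roots (c w : F) (e : bool) : c != 0 ->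
  ((exists2 x, x != 0 & c * x ^+ n = w) -> e) -> w != 0 ->
  (#|[set x : F | (c * x ^+ n == w)%R]| <= n * e)%N.
Proof.
move=> c0 ex_e w0; case: e ex_e => [_|ex_e].
  rewrite muln1; apply: leq_trans (card_nth_roots (w / c) n_gt0).
  by apply/subset_leq_card/subsetP => x; rewrite !inE => /eqP <-; rewrite mulrC mulKf.
rewrite muln0 leqn0 cards_eq0; apply/eqP/setP => x; rewrite !inE.
apply/negP => /eqP xw; apply: notF; apply: ex_e; exists x => //.
by apply: contraNneq w0 => x0; rewrite -xw x0 expr0n gtn_eqF // mulr0.
Qed.

(** Over [u = a x ^ n] there are at most [n] choices for each of [x] and [y]. On the lines [x = 0],
    [y = 0], [z = 0], taking [k]-th powers in the equation gives the three conditions, in this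
    order. *)
Lemma card_fermat_points_leq :
  (#|fermat_points n a b| <= n ^ 2 * #|line_points| +
    n * ((b ^+ k == 1%R) + (a ^+ k == 1%R) + (a ^+ k == (- b) ^+ k)%R))%N.
Proof.
apply: leq_trans (subset_leq_card fermat_points_sub) _.
apply: leq_trans (leq_of_leqif (leq_card_setU _ _)) _.
apply: leq_trans (leq_add (leq_imset_card _ _) (leq_imset_card _ _)) _.
rewrite mulnDr addnA leq_add //; last first.
  rewrite (eq_card (B := mem [set x : F | a * x ^+ n == - b])); last first.
    by move=> x; rewrite !inE addr_eq0.
  apply: card_scaled_roots; rewrite ?oppr_eq0 // => -[x x0 <-].
  by rewrite exprMn exp_pow_nk // mulr1.
pose A c := [set x : F | c * x ^+ n == 1].
pose root_pairs u := setX [set x : F | x ^+ n == u / a] [set y : F | y ^+ n == (1 - u) / b].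
pose B := (\bigcup_(u in line_points) root_pairs u) :|:
   (setX [set 0] (A b) :|: setX (A a) [set 0]).
apply: (@leq_trans #|B|).
  apply/subset_leq_card/subsetP => -[x y]; rewrite !inE /=.
  have [->|x0] := eqVneq x 0.
    by rewrite expr0n gtn_eqF // mulr0 add0r => ->; rewrite orbT.
  have [->|y0] := eqVneq y 0.
    by rewrite expr0n gtn_eqF // mulr0 addr0 => ->; rewrite !orbT.
  move=> /eqP xy; apply/orP; left; apply/bigcupP; exists (a * x ^+ n).
    by rewrite inE -xy [X in X - _]addrC addrK !exprMn !exp_pow_nk // !mulr1 !eqxx.
  by rewrite !inE /= -xy [X in X - _]addrC addrK ![_ * _ ^+ _]mulrC !mulfK ?eqxx.
apply: leq_trans (leq_of_leqif (leq_card_setU _ _)) _.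
rewrite mulnDr leq_add //.
  apply: leq_trans (leq_card_bigcup _ _) _.
  rewrite mulnC -sum_nat_const; apply: leq_sum => u _.
  by rewrite cardsX -mulnn leq_mul // card_nth_roots.
apply: leq_trans (leq_of_leqif (leq_card_setU _ _)) _; rewrite !cardsX !cards1 mul1n muln1 leq_add //;
  apply: card_scaled_roots; rewrite ?oner_eq0 // => -[x x0 /(congr1 (fun z => z ^+ k))];
  by rewrite exprMn exp_pow_nk // mulr1 expr1n => ->.
Qed.
End CountPoints.

(** * The numerical inequality *)

Lemma ler_cube (R : realFieldType) (x y : R) : 0 <= y -> x ^+ 3 <= y ^+ 3 -> x <= y.
Proof.
move=> y0; apply: contraTT; rewrite -!ltNge => ltyx.
by rewrite ltrXn2r // ?nnegrE // ltW // (le_lt_trans y0).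
Qed.

(** Positivity at two rational endpoints suffices where the cubic lies above its chord, which
    [12 * d <= 16 * (2 * lo + hi)] ensures for [t >= lo]. *)
Lemma cubic_pos_small (R : realFieldType) (t lo hi : R) (d : R) (k0 k1 : R) :
  0 <= t -> 0 <= lo -> 0 <= hi -> k0 <= 2 * t ^+ 3 <= k1 ->
  2 * lo ^+ 3 <= k0 -> k1 <= 2 * hi ^+ 3 ->
  12 * d <= 16 * (2 * lo + hi) ->
  0 < 12 * d * lo ^+ 2 - 14 * d * lo + 25 / 3 * d - 16 * lo ^+ 3
      - (d ^+ 3 - 7 * d ^+ 2 + 10 * d + 16) ->
  0 < 12 * d * hi ^+ 2 - 14 * d * hi + 25 / 3 * d - 16 * hi ^+ 3
      - (d ^+ 3 - 7 * d ^+ 2 + 10 * d + 16) ->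
  0 < 12 * d * t ^+ 2 - 14 * d * t + 25 / 3 * d - 16 * t ^+ 3
      - (d ^+ 3 - 7 * d ^+ 2 + 10 * d + 16).
Proof.
move=> t0 lo0 hi0 /andP [kt tk] lo_k hi_k c0 Glo Ghi.
have tlo : lo <= t by apply: ler_cube => //; lra.
have thi : t <= hi by apply: ler_cube => //; lra.
set G := fun x : R => 12 * d * x ^+ 2 - 14 * d * x + 25 / 3 * d - 16 * x ^+ 3
      - (d ^+ 3 - 7 * d ^+ 2 + 10 * d + 16).
rewrite -/(G lo) -/(G hi) -/(G t) in Glo Ghi *.
have [lohi|] := ltP lo hi; last by move=> h; have -> : t = lo by lra.
(* compare [G] with its chord on the interval from [lo] to [hi] *)
rewrite -(pmulr_rgt0 _ (_ : 0 < hi - lo)) ?subr_gt0 //.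
have -> : (hi - lo) * G t = (hi - t) * G lo + (t - lo) * G hi
   + (hi - lo) * ((t - lo) * (hi - t) * (16 * (t + lo + hi) - 12 * d)).
  by rewrite /G; ring.
have : 0 <= (t - lo) * (hi - t) * (16 * (t + lo + hi) - 12 * d).
  by rewrite !mulr_ge0 ?subr_ge0 //; lra.
move=> /(mulr_ge0 (_ : 0 <= hi - lo)); rewrite subr_ge0 => /(_ (ltW lohi)) h3.
apply: ltr_wpDr => //; have [lt_hi|ge_hi] := ltP t hi.
  by apply: ltr_pwDl; [apply: mulr_gt0 | apply: mulr_ge0 (ltW Ghi)]; lra.
by apply: ltr_wpDl; [apply: mulr_ge0 (ltW Glo) | apply: mulr_gt0]; lra.
Qed.

Lemma bound_lt_target (R : realFieldType) (t : R) (k d : nat) :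
  0 <= t -> 2 * t ^+ 3 = k%:R -> (4 <= d)%N -> (0 < k)%N ->
  ((d - 1) * d * (d - 4) < 4 * k + 8 <= d * d.+1 * (d - 3))%N ->
  d%:R ^+ 3 - 7 * d%:R ^+ 2 + 10 * d%:R + 16 + 8 * k%:R <
    4 * d%:R * (3 * t ^+ 2 - 7 / 2 * t + 25 / 12) :> R.
Proof.
move=> t0 tk d4 k0 /andP [klo khi].
suff : 0 < 12 * d%:R * t ^+ 2 - 14 * d%:R * t + 25 / 3 * d%:R - 16 * t ^+ 3
      - (d%:R ^+ 3 - 7 * d%:R ^+ 2 + 10 * d%:R + 16) by lra.
have bnds a b : (a <= k)%N -> (k <= b)%N -> a%:R <= 2 * t ^+ 3 <= b%:R.
  by move=> ak kb; rewrite tk !ler_nat ak.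
have [d10|d10] := leqP 10 d; last first.
  (* The margin is tiny here (about [10 ^ -4] at [d = 5], [k = 13]), so the exact
     range of the integer [k] is needed for each [d]. *)
  have : (d = 4 \/ d = 5 \/ d = 6 \/ d = 7 \/ d = 8 \/ d = 9)%N by lia.
  move=> [|[|[|[|[|]]]]] E; subst d.
  (* For [d = 4] the chord condition fails with endpoints near the cube roots of [1 / 2] and
     [3 / 2], so each [k] is treated separately. *)
  - have : (k = 1 \/ k = 2 \/ k = 3)%N by lia.
    move=> [|[|]] E; subst k; first nra.
      have t1 : 1 <= t by apply: ler_cube => //; lra.
      nra.
    have t8 : 8 / 7 <= t by apply: ler_cube => //; lra.
    nra.
  (* [lo] and [hi] are rational bounds, below and above, for the cube roots of half the extreme
     values of [k]; likewise in the next cases. *)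
  - by apply: (cubic_pos_small (lo := 5 / 4) (hi := 321 / 172) t0 _ _ (bnds 4%N 13%N _ _)); first [lia | lra].
  - by apply: (cubic_pos_small (lo := 15 / 8) (hi := 22 / 9) t0 _ _ (bnds 14%N 29%N _ _)); first [lia | lra].
  - by apply: (cubic_pos_small (lo := 17 / 7) (hi := 3) t0 _ _ (bnds 30%N 54%N _ _)); first [lia | lra].
  - by apply: (cubic_pos_small (lo := 3) (hi := 18 / 5) t0 _ _ (bnds 55%N 88%N _ _)); first [lia | lra].
  - by apply: (cubic_pos_small (lo := 7 / 2) (hi := 29 / 7) t0 _ _ (bnds 89%N 133%N _ _)); first [lia | lra].
set s : R := d%:R; have s10 : 10 <= s by rewrite /s ler_nat.
have {}klo : s ^+ 3 - 5 * s ^+ 2 + 4 * s < 8 * t ^+ 3 + 8.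
  have := klo; rewrite -(ltr_nat R) natrD !natrM !natrB; try lia.
  by rewrite -tk -/s => h; lra.
have {}khi : 8 * t ^+ 3 + 8 <= s ^+ 3 - 2 * s ^+ 2 - 3 * s.
  have := khi; rewrite -(ler_nat R) natrD !natrM !natrB; try lia.
  by rewrite -tk -addn1 natrD -/s => h; lra.
have t_hi : 2 * t <= s - 2 / 3.
  by apply: ler_cube; [lra | nra].
have t_lo : s - 2 <= 2 * t.
  by apply: ler_cube; [lra | nra].
(* In terms of [e = s - 2 t] the powers [s ^ 3] and [s ^ 2] cancel, leaving four times [s (e (7 / 4
   - 3 e / 4) - 5 / 12) + e ^ 3 / 2 - 4]. The coefficient of [s] is nonnegative for
   [2 / 3 <= e <= 2], so [s = 10] is the worst case. *)
have -> : t = (s - (s - 2 * t)) / 2 by field.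
set e := s - 2 * t.
have e1 : 2 / 3 <= e by rewrite /e; lra.
have e2 : e <= 2 by rewrite /e; lra.
have h : 0 <= (s - 10) * (e * (7 / 4 - 3 / 4 * e) - 5 / 12).
  apply: mulr_ge0; first lra.
  nra.
have h2 : 0 < 10 * (e * (7 / 4 - 3 / 4 * e) - 5 / 12) + e ^+ 3 / 2 - 4.
  nra.
nra.
Qed.

(** * The bound in terms of [d], and the conclusion *)

Lemma invr_eq_scaled_inv (F : fieldType) (A B s : F) :
  A != 0 -> B != 0 -> s != 0 -> (B^-1 == s * A^-1) = (A == s * B).
Proof.
move=> A0 B0 s0; apply/eqP/eqP => [E|->]; last by rewrite invfM mulrA mulfV ?mul1r.
by rewrite -[LHS]mul1r -(mulfV B0) E; field.
Qed.

(** This is [stepanov_bound] with [m = d - 3]. As [2 (N - 1) = m (m + 3)], a factor [m] cancels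
    throughout. The last hypothesis on [d] provides [m <= k]. *)
Lemma line_points_bound (p n k d : nat) (a b : 'F_p) :
  prime p -> odd p -> p = (n * k).+1 -> a != 0 -> b != 0 ->
  (4 <= d <= n)%N -> ((d - 1) * d * (d - 4) < 4 * k + 8)%N ->
  (4 * d * #|line_points k a b| +
    8 * ((b ^+ k == 1%R) + (a ^+ k == 1%R) + (a ^+ k == (- b) ^+ k)%R) + 7 * d ^ 2 <=
   d ^ 3 + 10 * d + 16 + 8 * k)%N.
Proof.
move=> pr_p odd_p def_p a0 b0 /andP [d4 led] kd.
have k_gt0 : (0 < k)%N by case: (k) def_p pr_p => // ->; rewrite muln0.
have [m m_gt0 def_d] : exists2 m, (0 < m)%N & (d = m + 3)%N by exists (d - 3)%N; lia.
subst d; have lemk : (m <= k)%N.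
  rewrite leqNgt; apply/negP => ltkm; move: kd.
  have -> : (m + 3 - 1 = m + 2)%N by lia. have -> : (m + 3 - 4 = m - 1)%N by lia.
  by case: m m_gt0 ltkm {d4 led} => [|[|m]] _ ltkm; [| |have := leq_mul (leqnn 4) ltkm]; nia.
have cardN := card_triangle m.
(* [2 N = m (m + 3) + 2 <= n k + 2 = p + 1]. *)
have leNp : (#|triangle m| <= p)%N.
  have : ((m + 3) * m <= n * k)%N by rewrite leq_mul.
  by rewrite def_p; nia.
have pF : p \in [pchar 'F_p] by rewrite pchar_Fp.
have ltmn : (m < n)%N by lia.
have ak0 : a ^+ k != 0 by rewrite expf_neq0.
have bk0 : b ^+ k != 0 by rewrite expf_neq0.
have := stepanov_bound pF def_p k_gt0 ak0 bk0 ltmn lemk leNp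
  (enum_uniq (line_points k a b)).
set S := line_points k a b; set M := #|triangle m|.-1.
have S_sol x : x \in enum S -> x ^+ k = a ^+ k /\ (1 - x) ^+ k = b ^+ k.
  by rewrite mem_enum inE => /andP [/eqP -> /eqP ->].
move=> /(_ S_sol); rewrite -cardE sum_triangle2 -/M.
have -> : ((b ^+ k)^-1 + (-1) ^+ (p - k) * (a ^+ k)^-1 == 0) = (a ^+ k == (- b) ^+ k).
  (* As [p] is odd, the leading coefficient at infinity vanishes exactly when
     [a ^ k = (- b) ^ k]. *)
  have sgn : (-1) ^+ (p - k) = - (-1) ^+ k :> 'F_p.
    rewrite -signr_odd oddB ?odd_p; last by rewrite def_p; nia.
    by rewrite -[in RHS]signr_odd; case: (odd k); rewrite /= ?expr0 ?expr1 ?opprK.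
  rewrite sgn [(- b) ^+ k]exprNn mulNr subr_eq0.
  have s0 : (-1) ^+ k != 0 :> 'F_p by rewrite signr_eq0.
  exact: invr_eq_scaled_inv.
have defM : (2 * M = m * (m + 3))%N by rewrite /M; lia.
have : (4 * (M * M.-1) = m * (m + 3) * (m * (m + 3) - 2))%N.
  by rewrite -defM; have := m_gt0; nia.
have -> : (m * (m + 3) - 2 = (m - 1) * (m + 3) + (m + 1))%N.
  by case: (m) m_gt0 => // m' _; rewrite subn1 /=; lia.
move: (M * M.-1)%N => P defP.
set z1 := b ^+ k == 1; set z2 := a ^+ k == 1; set z3 := a ^+ k == _.
have -> : ((if z1 then 0 else m) + (if z2 then 0 else m) + (k * m + if z3 then 0 else m) =
   m * (k + (3 - (z1 + z2 + z3))))%N by clear; case: z1; case: z2; case: z3; rewrite /=; lia.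
have : (z1 + z2 + z3 <= 3)%N by case: z1; case: z2; case: z3.
move: (z1 + z2 + z3)%N #|S| => z L lez H.
rewrite -(leq_pmul2l m_gt0).
have : (4 * (2 * M) * L + 4 * (m * m.+1 * m.+2) <= 4 * P + 8 * (m * (k + (3 - z))))%N.
  by move: H; move: (m * (k + _))%N (m * m.+1 * m.+2)%N; clear => Y T; lia.
rewrite defM defP; move: lez; clear -m_gt0; case: m m_gt0 => // m _.
rewrite subn1 /=; case: z => [|[|[|[|//]]]] _; lia.
Qed.

Theorem mainTheorem1 (R : realType) (p : nat) (hp : prime p)
    (a b : 'F_p) (ha : a != 0) (hb : b != 0)
    (n : nat) (hn : (4 <= n)%N) (hdvd : (n %| p - 1)%N)
    (hbound : 4 * (p%:Z - 1) <=
      n%:Z ^+ 4 - 2 * n%:Z ^+ 3 - 3 * n%:Z ^+ 2 - 8 * n%:Z) :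
  let k : R := ((p - 1) %/ n)%N%:R in
  (fermat_count n a b)%:R <
    n%:R ^+ 2 * (3 * (k / 2) `^ (2 / 3) - 7 / 2 * (k / 2) `^ (1 / 3) + 25 / 12).
Proof.
cbv zeta; set kR : R := (_ %/ _)%:R; have p_gt1 := prime_gt1 hp.
have [k def_k] : exists k, k = ((p - 1) %/ n)%N by eexists.
have def_p : p = (n * k).+1.
  by rewrite def_k mulnC divnK //; lia.
have k_gt0 : (0 < k)%N by case: (k) def_p p_gt1 => //; rewrite muln0 => ->.
have kn : (4 * k + 8 <= n * n.+1 * (n - 3))%N.
  have : (n%:Z * (4 * k%:Z + 8) <= n%:Z * (n%:Z * (n%:Z + 1) * (n%:Z - 3))).
    have -> : n%:Z * (n%:Z * (n%:Z + 1) * (n%:Z - 3)) =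
      n%:Z ^+ 4 - 2 * n%:Z ^+ 3 - 3 * n%:Z ^+ 2 by ring.
    have pn : p%:Z - 1 = n%:Z * k%:Z by rewrite def_p -addn1 PoszD PoszM addrK.
    by move: hbound; rewrite pn; lra.
  rewrite ler_pM2l; last by lia.
  have -> : n%:Z - 3 = (n - 3)%N%:Z by lia.
  nia.
have odd_p : odd p.
  have [p2|] := even_prime hp; last by [].
  by move: def_p; rewrite p2; nia.
pose good d := (4 <= d)%N && (4 * k + 8 <= d * d.+1 * (d - 3))%N.
have ex_good : exists d, good d by exists n; rewrite /good hn kn.
have [d /andP [d4 kd] min_d] := ex_minnP ex_good.
have led : (d <= n)%N by apply: min_d; rewrite /good hn kn.
(* Minimality of [d], applied to [d - 1]; for [d = 4] the left side is [0]. *)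
have ltd : ((d - 1) * d * (d - 4) < 4 * k + 8)%N.
  have [->|d5] := eqVneq d 4; first by rewrite subnn muln0; lia.
  rewrite ltnNge; apply/negP => le_k.
  have : good (d - 1)%N.
    apply/andP; split; first by lia.
    have -> : (d - 1).+1 = d by lia.
    by have -> : (d - 1 - 3 = d - 4)%N by lia.
  by move=> /min_d; lia.
have lineB := line_points_bound hp odd_p def_p ha hb (introT andP (conj d4 led)) ltd.
have cardFp : #|'F_p| = (n * k).+1 by rewrite card_Fp.
have ptsB := card_fermat_points_leq (ltnW (ltnW (ltnW hn))) cardFp ha hb.
move: lineB ptsB; set z := ((b ^+ k == 1%R) + (a ^+ k == 1%R) + _)%N; set L := #|line_points _ _ _| => lineB ptsB.
(* Since [d <= n], the contribution [4 d n z] of the coordinate lines is at most [8 n ^ 2 z]. *)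
have natB : (4 * d * fermat_count n a b + 7 * d ^ 2 * n ^ 2 <=
    n ^ 2 * (d ^ 3 + 10 * d + 16 + 8 * k))%N.
  apply: (@leq_trans (n ^ 2 * (4 * d * L + 8 * z + 7 * d ^ 2))%N); last by rewrite leq_mul2l lineB orbT.
  have := leq_mul (leqnn (4 * d)%N) ptsB; rewrite /fermat_count.
  have : (d * (n * z) <= n * (n * z))%N by rewrite leq_mul2r led orbT.
  by rewrite -!mulnn; lia.
have [t t0 [t1 t2]] : exists2 t : R, 0 <= t & (kR / 2) `^ (1 / 3) = t /\ (kR / 2) `^ (2 / 3) = t ^+ 2.
  exists ((kR / 2) `^ (1 / 3)); first exact: powR_ge0.
  split=> //; rewrite -powR_mulrn ?powR_ge0 // -powRrM; congr (_ `^ _); lra.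
have t3 : 2 * t ^+ 3 = k%:R.
  rewrite -t1 -powR_mulrn ?powR_ge0 // -powRrM.
  have -> : 1 / 3 * 3%:R = 1 :> R by lra.
  by rewrite powRr1 ?divr_ge0 ?ler0n // /kR -def_k; lra.
have tgt := bound_lt_target t0 t3 d4 k_gt0 (introT andP (conj ltd kd)).
rewrite t1 t2.
have d_gt0 : 0 < 4 * d%:R :> R by rewrite mulr_gt0 // ltr0n (leq_trans _ d4).
rewrite -(ltr_pM2l d_gt0).
have n2_gt0 : 0 < n%:R ^+ 2 :> R by rewrite exprn_gt0 // ltr0n (leq_trans _ hn).
have := natB; rewrite -(ler_nat R) !(natrD, natrM, natrX) => rB.
rewrite mulrCA; apply: le_lt_trans (_ : _ <= n%:R ^+ 2 *
  (d%:R ^+ 3 - 7 * d%:R ^+ 2 + 10 * d%:R + 16 + 8 * k%:R)) _.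
  have -> : n%:R ^+ 2 * (d%:R ^+ 3 - 7 * d%:R ^+ 2 + 10 * d%:R + 16 + 8 * k%:R) =
      n%:R ^+ 2 * (d%:R ^+ 3 + 10 * d%:R + 16 + 8 * k%:R) - 7 * d%:R ^+ 2 * n%:R ^+ 2 :> R.
    by ring.
  by rewrite lerBrDr.
by rewrite (ltr_pM2l n2_gt0).
Qed.
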